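(* Suppose that the inputs $\mu_0$ and $\bar M_0$ of R-FISTA satisfy $\mu_0\ge\bar\mu$ and $\bar M_0\le2\bar L$. Then R-FISTA terminates with a pair $(y,v)$ that is an $\epsilon$-optimal solution, i.e. $\|v\|\le\epsilon$ and $v\in\nabla\psi_s(y)+\partial\psi_n(y)$, in at most $$\mathcal O_1\left(\left\lceil\log_2^{++}(\mu_0/\bar\mu)\right\rceil\left[\sqrt{\frac{\bar L}{\bar\mu}}\,\log^{++}\left(\frac{D\bar L}{\epsilon}\right)+\log_2^+(\bar L/\bar M_0)\right]\right)$$ ACG iterations/gradient evaluations. Hence R-FISTA performs $\mathcal O\left(\sqrt{\bar L/\bar\mu}\,\log(D\bar L/\epsilon)\right)$ ACG iterations/gradient evaluations to find an $\epsilon$-optimal solution.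
   Context: Problem: minimize $\psi=\psi_s+\psi_n$ over a finite-dimensional inner product space $\mathbb E$, where $\psi$ is $\bar\mu$-strongly convex ($\bar\mu>0$), $\psi_s:\mathbb E\to\mathbb R$ is convex and differentiable with $\bar L$-Lipschitz gradient, and $\psi_n$ is closed proper convex with compact convex domain $\operatorname{dom}\psi_n$ of diameter $D$. Notation: $\log_b^+(t)=\max\{\log_bt,0\}$, $\log_b^{++}(t)=\max\{\log_bt,1\}$, natural log if no base; $\mathcal O_1(\cdot)=\mathcal O(1+\cdot)$; $\ell_{\psi_s}(z;\bar z)=\psi_s(\bar z)+\langle\nabla\psi_s(\bar z),z-\bar z\rangle$. R-FISTA (inputs $\chi\in(0,1)$, $(\mu_0,\bar M_0)\in\mathbb R_{++}^2$, tolerance $\epsilon>0$, $(\psi_s,\psi_n)$, $\bar x_0\in\operatorname{dom}\psi_n$). It runs cycles $\ell=1,2,\dots$. Initialization of cycle $\ell$: $j=0$, choose $\underline M_\ell\in[\max\{0.25\bar M_{\ell-1},\bar M_0\},\bar M_{\ell-1}]$, set $\tilde\mu=\mu_{\ell-1}$, $(A_0,\tau_0,L_0)=(0,1,\underline M_\ell)$, choose $x_0\in\operatorname{dom}\psi_n$ (with $x_0=\bar x_0$ if $\ell=1$), $y_0=x_0$. Then for $j=1,2,\dots$ (inner ACG iterations): (1) set $L_j=L_{j-1}$ and compute $a_{j-1}=\frac{\tau_{j-1}+\sqrt{\tau_{j-1}^2+4\tau_{j-1}A_{j-1}L_j}}{2L_j}$, $\tilde x_{j-1}=\frac{A_{j-1}y_{j-1}+a_{j-1}x_{j-1}}{A_{j-1}+a_{j-1}}$,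 $y_j=\operatorname{prox}_{(1/L_j)\psi_n}(\tilde x_{j-1}-\frac1{L_j}\nabla\psi_s(\tilde x_{j-1}))$; while $\ell_{\psi_s}(y_j;\tilde x_{j-1})+\frac{(1-\chi)L_j}{4}\|y_j-\tilde x_{j-1}\|^2<\psi_s(y_j)$, replace $L_j$ by $2L_j$ and recompute these three quantities; (2) set $A_j=A_{j-1}+a_{j-1}$, $\tau_j=\tau_{j-1}+\frac{a_{j-1}\tilde\mu}2$, $s_j=L_j(\tilde x_{j-1}-y_j)$, $x_j=\frac1{\tau_j}\left[\frac{\tilde\mu a_{j-1}y_j}2+\tau_{j-1}x_{j-1}-a_{j-1}s_j\right]$, $v_j=\nabla\psi_s(y_j)-\nabla\psi_s(\tilde x_{j-1})+s_j$; (3) if $\|y_j-x_0\|^2\ge\chi A_jL_j\|y_j-\tilde x_{j-1}\|^2$ fails, restart: set $\bar M_\ell=L_j$, $\mu_\ell=0.5\tilde\mu$ and start cycle $\ell+1$; otherwise, if $\|v_j\|\le\epsilon$, stop and output $(y,v)=(y_j,v_j)$.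
   Formalization: The O-constants depend on χ and on an arbitrary positive lower bound for L̄/μ̄ (uniformity over all ratios is false); the final ''Hence'' bound is stated for μ_0/μ̄ and L̄/M̄_0 bounded above and DL̄/ε ≥ θ > 1, its constant depending also on these bounds. *)

(* Defs.v *)
From HB Require Import structures.
From mathcomp Require Import all_boot all_order all_algebra.
From mathcomp Require Import sesquilinear.
From mathcomp Require Import all_classical all_reals all_analysis.

Set Implicit Arguments.
Unset Strict Implicit.
Unset Printing Implicit Defensive.

Import Order.TTheory GRing.Theory Num.Theory.
Import numFieldNormedType.Exports.

Local Open Scope classical_set_scope.
Local Open Scope ring_scope.

Section inner_product_space.
Context {R : realType} {E : normedModType R}.

Definition finite_dimensional : Prop :=
  exists (m : nat) (b : 'I_m -> E),
    forall x : E, exists c : 'I_m -> R, x = \sum_i c i *: b i.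

(* The norm (hence the topology) of [E] is the one induced by [dot]. *)
Definition norm_from_dot (dot : {dot E for idfun}) : Prop :=
  forall x : E, `|x| ^+ 2 = dot x x.

(* [g] is the gradient of the everywhere (Frechet) differentiable [f]. *)
Definition is_gradient (dot : {dot E for idfun}) (f : E -> R) (g : E -> E) :
    Prop :=
  forall x : E, differentiable f x /\ forall h : E, 'd f x h = dot (g x) h.

Definition diameter (A : set E) : R :=
  sup [set r | exists x y : E, [/\ A x, A y & r = `|x - y|]].

End inner_product_space.

Section extended_real_functions.
Context {R : realType} {E : normedModType R}.
Local Open Scope ereal_scope.

Definition edom (f : E -> \bar R) : set E := [set x | f x < +oo].

Definition eproper (f : E -> \bar R) : Prop :=
  (forall x, -oo < f x) /\ edom f !=set0.

Definition eclosed (f : E -> \bar R) : Prop :=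
  closed [set p : E * R | f p.1 <= p.2%:E].

(* The terms below are only used for functions that avoid -oo. *)
Definition strongly_convex (mu : R) (f : E -> \bar R) : Prop :=
  forall (x y : E) (t : R), (0 < t < 1)%R ->
    f (t *: x + (1 - t) *: y)%R + (mu / 2 * t * (1 - t) * `|x - y| ^+ 2)%R%:E
      <= t%:E * f x + (1 - t)%R%:E * f y.

Definition econvex (f : E -> \bar R) : Prop :=
  forall (x y : E) (t : R), (0 < t < 1)%R ->
    f (t *: x + (1 - t) *: y)%R <= t%:E * f x + (1 - t)%R%:E * f y.

(* [y] minimizes [u |-> f u + `|u - z|^2 / (2 lam)], i.e. y = prox_{lam f}(z). *)
Definition is_prox (lam : R) (f : E -> \bar R) (z y : E) : Prop :=
  forall u : E, f y + (`|y - z| ^+ 2 / (2 * lam))%R%:E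
             <= f u + (`|u - z| ^+ 2 / (2 * lam))%R%:E.

Definition subdifferential (dot : {dot E for idfun}) (f : E -> \bar R) (y : E) :
    set E :=
  [set g | forall z : E, f y + (dot g (z - y)%R)%:E <= f z].

End extended_real_functions.

Section logarithms.
Context {R : realType}.

(* [ln] is 0 at nonpositive arguments, so [logpp 0 = 1] as it should. *)
Definition log2 (t : R) : R := ln t / ln 2.
Definition log2p (t : R) : R := Num.max (log2 t) 0.
Definition log2pp (t : R) : R := Num.max (log2 t) 1.
Definition logpp (t : R) : R := Num.max (ln t) 1.

Definition rfista_complexity (mubar Lbar D mu0 Mbar0 eps : R) : R :=
  (Num.ceil (log2pp (mu0 / mubar)))%:~R
    * (Num.sqrt (Lbar / mubar) * logpp (D * Lbar / eps) + log2p (Lbar / Mbar0)).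

End logarithms.

Section rfista.
Context {R : realType} {E : normedModType R}.

(* State of a cycle when the trial value [acg_L] of L_j is about to be tested.
   [acg_mu] is mu-tilde; [acg_A], [acg_tau], [acg_x], [acg_y] carry index
   j - 1. *)
Record acg_state := AcgState {
  acg_mu : R; acg_x0 : E; acg_A : R; acg_tau : R; acg_L : R;
  acg_x : E; acg_y : E }.

Definition acg_a (s : acg_state) : R :=
  (acg_tau s + Num.sqrt (acg_tau s ^+ 2 + 4 * acg_tau s * acg_A s * acg_L s))
    / (2 * acg_L s).

Definition acg_xtilde (s : acg_state) : E :=
  (acg_A s + acg_a s)^-1 *: (acg_A s *: acg_y s + acg_a s *: acg_x s).

Definition acg_Anext (s : acg_state) : R := acg_A s + acg_a s.

Definition acg_taunext (s : acg_state) : R :=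
  acg_tau s + acg_a s * acg_mu s / 2.

Definition acg_s (s : acg_state) (y : E) : E :=
  acg_L s *: (acg_xtilde s - y).

Definition acg_xnext (s : acg_state) (y : E) : E :=
  (acg_taunext s)^-1 *:
    ((acg_mu s * acg_a s / 2) *: y + acg_tau s *: acg_x s
      - acg_a s *: acg_s s y).

Definition acg_v (grad : E -> E) (s : acg_state) (y : E) : E :=
  grad y - grad (acg_xtilde s) + acg_s s y.

Definition acg_double (s : acg_state) : acg_state :=
  AcgState (acg_mu s) (acg_x0 s) (acg_A s) (acg_tau s) (2 * acg_L s)
    (acg_x s) (acg_y s).

Definition acg_next (s : acg_state) (y : E) : acg_state :=
  AcgState (acg_mu s) (acg_x0 s) (acg_Anext s) (acg_taunext s) (acg_L s)
    (acg_xnext s y) y.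

(* [y] is the candidate for y_j computed with the trial value of L_j. *)
Definition acg_candidate (grad : E -> E) (psin : E -> \bar R) (s : acg_state)
    (y : E) : Prop :=
  is_prox (1 / acg_L s) psin
    (acg_xtilde s - (1 / acg_L s) *: grad (acg_xtilde s)) y.

Definition linearization (dot : {dot E for idfun}) (psis : E -> R)
    (grad : E -> E) (z zbar : E) : R :=
  psis zbar + dot (grad zbar) (z - zbar).

(* The test under which the while loop of step (1) doubles L_j. *)
Definition acg_too_small (dot : {dot E for idfun}) (psis : E -> R)
    (grad : E -> E) (chi : R) (s : acg_state) (y : E) : Prop :=
  linearization dot psis grad y (acg_xtilde s)
    + (1 - chi) * acg_L s / 4 * `|y - acg_xtilde s| ^+ 2 < psis y.

(* The test of step (3); its failure triggers a restart. *)
Definition acg_test (chi : R) (s : acg_state) (y : E) : Prop :=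
  `|y - acg_x0 s| ^+ 2
    >= chi * acg_Anext s * acg_L s * `|y - acg_xtilde s| ^+ 2.

(* [CycleStart l M mu]: cycle [l] is about to be initialized, with
   M = Mbar_(l-1) and mu = mu_(l-1). *)
Inductive rfista_phase :=
| CycleStart (l : nat) (M mu : R)
| Inner (l : nat) (s : acg_state)
| Stop (y v : E).

(* [iterations] counts the completed ACG iterations over all cycles, and
   [evaluations] the evaluations of the gradient of psi_s: one at x-tilde per
   trial of the line search, plus one at y_j when the trial is accepted. *)
Record rfista_config := Config {
  phase : rfista_phase; iterations : nat; evaluations : nat }.

Inductive rfista_step (dot : {dot E for idfun}) (psis : E -> R)
    (grad : E -> E) (psin : E -> \bar R) (chi Mbar0 eps : R) (xbar0 : E) :
    rfista_config -> rfista_config -> Prop :=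
| step_init l M mu Mlow x0 it ev :
    Num.max (M / 4) Mbar0 <= Mlow <= M ->
    edom psin x0 ->
    (l = 1%N -> x0 = xbar0) ->
    rfista_step dot psis grad psin chi Mbar0 eps xbar0
      (Config (CycleStart l M mu) it ev)
      (Config (Inner l (AcgState mu x0 0 1 Mlow x0 x0)) it ev)
| step_double l s y it ev :
    acg_candidate grad psin s y ->
    acg_too_small dot psis grad chi s y ->
    rfista_step dot psis grad psin chi Mbar0 eps xbar0
      (Config (Inner l s) it ev)
      (Config (Inner l (acg_double s)) it ev.+1)
| step_restart l s y it ev :
    acg_candidate grad psin s y ->
    ~ acg_too_small dot psis grad chi s y ->
    ~ acg_test chi s y ->
    rfista_step dot psis grad psin chi Mbar0 eps xbar0
      (Config (Inner l s) it ev)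
      (Config (CycleStart l.+1 (acg_L s) (acg_mu s / 2)) it.+1 ev.+2)
| step_stop l s y it ev :
    acg_candidate grad psin s y ->
    ~ acg_too_small dot psis grad chi s y ->
    acg_test chi s y ->
    `|acg_v grad s y| <= eps ->
    rfista_step dot psis grad psin chi Mbar0 eps xbar0
      (Config (Inner l s) it ev)
      (Config (Stop y (acg_v grad s y)) it.+1 ev.+2)
| step_next l s y it ev :
    acg_candidate grad psin s y ->
    ~ acg_too_small dot psis grad chi s y ->
    acg_test chi s y ->
    eps < `|acg_v grad s y| ->
    rfista_step dot psis grad psin chi Mbar0 eps xbar0
      (Config (Inner l s) it ev)
      (Config (Inner l (acg_next s y)) it.+1 ev.+2).

Definition rfista_start (mu0 Mbar0 : R) : rfista_config :=
  Config (CycleStart 1 Mbar0 mu0) 0 0.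

Definition rfista_stopped (c : rfista_config) : Prop :=
  exists y v : E, phase c = Stop y v.

Inductive rfista_reachable (step : rfista_config -> rfista_config -> Prop)
    (c0 : rfista_config) : rfista_config -> Prop :=
| reachable_start : rfista_reachable step c0 c0
| reachable_step c c' : rfista_reachable step c0 c -> step c c' ->
    rfista_reachable step c0 c'.

(* A maximal execution, extended by repetition once it has stopped. *)
Definition rfista_run (step : rfista_config -> rfista_config -> Prop)
    (c0 : rfista_config) (run : nat -> rfista_config) : Prop :=
  run 0%N = c0 /\
  forall n, step (run n) (run n.+1)
         \/ (rfista_stopped (run n) /\ run n.+1 = run n).

Definition eps_optimal (dot : {dot E for idfun}) (grad : E -> E)
    (psin : E -> \bar R) (eps : R) (y v : E) : Prop :=
  `|v| <= eps /\
  exists2 g : E, subdifferential dot psin y g & v = grad y + g.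

End rfista.

(* Main.v *)
Require Import Defs.
From HB Require Import structures.
From mathcomp Require Import all_boot all_order all_algebra.
From mathcomp Require Import sesquilinear.
From mathcomp Require Import all_classical all_reals all_analysis.
From mathcomp Require Import ring lra zify.

Set Implicit Arguments.
Unset Strict Implicit.
Unset Printing Implicit Defensive.

Import Order.TTheory GRing.Theory Num.Theory.
Import numFieldNormedType.Exports.

Local Open Scope classical_set_scope.
Local Open Scope ring_scope.

(** The proof runs an accelerated estimate sequence inside each cycle, and then
counts cycles, iterations and line-search doublings.

Write psi = psi_s + psi_n and let e = xtilde - y for an accepted trial point y
with step parameter L. Optimality in the prox step makes L e a subgradient at
y of the model [z |-> linearization z + psi_n z], and acceptance says that the
model falls short of psi at y by at most delta = (1 - chi) L |e|^2 / 4. As psi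
dominates the model, psi dominates the affine function
psi y + L <e, . - y> - delta ([accepted_lower_model]). Strong convexity is
available for the sum psi only; using it between u, y and their midpoint
doubles delta and gains mu |u - y|^2 / 4 whenever mu <= mubar
([accepted_strong_lower_model]).

The sum G of these minorants with weights a satisfies
G + |. - x0|^2 / 2 >= A psi y + chi A L |e|^2 / 2 + tau |. - x|^2 / 2
whatever the trial value mu, and G <= A psi on the domain as soon as
mu <= mubar ([estimate_sequence_next]). Evaluating both at y shows that the
restart test cannot fail when mu <= mubar ([acg_test_true]). Restarts
therefore only halve values above mubar: mu never falls to mubar / 2, and
there are at most 1 + ceil (log2 (mu0 / mubar)) cycles.

A trial value of L that is doubled is below 4 Lbar / (1 - chi), and
Mbar0 <= 2 Lbar; so all trial values are at most Lhat = 8 Lbar / (1 - chi),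
and a cycle makes at most log2 (Lhat / Mbar0) doublings. Inside a cycle the
product A L is at least 1 after one iteration and is then multiplied by at
least 1 + r per iteration, where r^2 = mubar / (4 Lhat) ([growth_next]);
following A L rather than A keeps
Lbar / Mbar0 out of the logarithm. While the restart test succeeds,
chi A L |e|^2 <= D^2, and |v| <= (Lbar + L) |e|; so |v| <= eps within
O(sqrt (Lbar / mubar) log (D Lbar / eps)) iterations ([not_stopped_lt],
[cycle_length_bound]).

Multiplying the counts ([rfista_run_stops]) gives the first bound; the additive
constants are absorbed because sqrt (Lbar / mubar) is at least sqrt kappa and
the truncated logarithm is at least 1. The second bound is then arithmetic
([complexity_le_main_term]). *)

(** * Inner products *)

Section inner_product.
Context {R : realType} {E : normedModType R} (dot : {dot E for idfun}).
Hypothesis normE : norm_from_dot dot.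
Implicit Types (x y : E) (a : R).

Lemma dotC x y : dot x y = dot y x.
Proof. by rewrite hermC/= expr0 mul1r. Qed.

Lemma dotZr a x y : dot x (a *: y) = a * dot x y.
Proof. by rewrite linearZr. Qed.

Lemma dotZl a x y : dot (a *: x) y = a * dot x y.
Proof. by rewrite dotC dotZr dotC. Qed.

Lemma normsqD x y : `|x + y| ^+ 2 = `|x| ^+ 2 + 2 * dot x y + `|y| ^+ 2.
Proof. rewrite !normE linearDl/= !linearDr/= (dotC y x); ring. Qed.

Lemma normsqB x y : `|x - y| ^+ 2 = `|x| ^+ 2 - 2 * dot x y + `|y| ^+ 2.
Proof. rewrite !normE linearBl/= !linearBr/= (dotC y x); ring. Qed.

Lemma normsqZ a x : `|a *: x| ^+ 2 = a ^+ 2 * `|x| ^+ 2.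
Proof. by rewrite normrZ exprMn real_normK ?num_real. Qed.

Lemma dot_le_norm x y : dot x y <= `|x| * `|y|.
Proof.
have : `|x + y| ^+ 2 <= (`|x| + `|y|) ^+ 2.
  by rewrite ler_pXn2r ?nnegrE ?addr_ge0 ?normr_ge0 ?ler_normD.
rewrite normsqD; lra.
Qed.

End inner_product.

(** * Smooth convex functions *)

Section smooth.
Context {R : realType} {E : normedModType R} (dot : {dot E for idfun}).
Context (f : E -> R) (g : E -> E).

Lemma lipschitz_dist_le (L : R) : L.-lipschitz_setT g ->
  forall x y, `|g x - g y| <= L * `|x - y|.
Proof. by move=> gL x y; exact: (gL (x, y)). Qed.

(** The derivative of [f] at [x] along [y - x] is a limit from the right of
difference quotients, and convexity bounds each of them by [f y - f x]. *)
Lemma convex_gradient_ineq :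
  convex_function (setT : set (convex_lmodType E)) f ->
  is_gradient dot f g -> forall x y, f x + dot (g x) (y - x) <= f y.
Proof.
move=> cf gf x y.
have [df dg] := gf x.
rewrite -dg -lerBrDl -deriveE//.
have dfx : derivable f x (y - x) by exact: diff_derivable.
rewrite /derive cvg_at_rightE//.
apply: limr_le; first exact: cvgP (cvg_dnbhs_at_right dfx).
near=> t.
have t0 : 0 < t by near: t; exact: nbhs_right_gt.
have t1 : t <= 1 by near: t; apply: nbhs_right_le.
have tc : f (t *: y + (1 - t) *: x) <= t * f y + (1 - t) * f x.
  by apply: (cf (Itv01 (ltW t0) t1) y x); rewrite inE.
rewrite /= /GRing.scale/= ler_pdivrMl//.
have -> : t *: (y - x) + x = t *: y + (1 - t) *: x.
  by rewrite scalerBr scalerBl scale1r -addrA [in RHS](addrC x).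
lra.
Unshelve. all: by end_near. Qed.

End smooth.

(** * Proximal points *)

Section prox.
Context {R : realType} {E : normedModType R} (dot : {dot E for idfun}).
Hypothesis normE : norm_from_dot dot.
Context (f : E -> \bar R).
Hypotheses (pf : eproper f) (clf : eclosed f) (cvf : econvex f)
  (cpf : compact (edom f)).

Lemma edom_fin_num u : edom f u -> f u \is a fin_num.
Proof. by move=> fu; rewrite fin_numElt fu (pf.1 u). Qed.

(** The strict sublevel sets of the prox objective at levels above its infimum
generate a proper filter on the compact domain. A cluster point of that filter
lies in every closed sublevel set, hence attains the infimum. *)
Lemma prox_exists (lam : R) (z : E) : exists y, is_prox lam f z y.
Proof.
pose q u := `|u - z| ^+ 2 / (2 * lam).
pose h u := (f u + (q u)%:E)%E.
have hfin u : f u \is a fin_num -> h u \is a fin_num.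
  by move=> ?; rewrite fin_numD andbC.
have [x0 dx0] := pf.2.
have hx0 : (h x0 < (fine (h x0) + 1)%:E)%E.
  by rewrite -{1}(fineK (hfin _ (edom_fin_num dx0))) lte_fin ltrDl.
pose m := ereal_inf (range h).
have mh u : (m <= h u)%E by apply: ereal_inf_lbound; exists u.
have mlt : (m < +oo)%E.
  exact: le_lt_trans (mh x0) (lt_le_trans hx0 (leey _)).
have mc0 := le_lt_trans (mh x0) hx0.
pose F : set_system E :=
  [set A | exists2 c : R, (m < c%:E)%E & [set u | (h u < c%:E)%E] `<=` A].
have FF : ProperFilter F.
  split.
    move=> [c mc] /=.
    have [_ [u _ <-] hu] := ereal_inf_lt mc.
    by move=> /(_ u) /=; apply.
  split.
  - by exists (fine (h x0) + 1).
  - move=> P Q [c mc cP] [c' mc' cQ].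
    exists (Num.min c c').
      by rewrite EFin_min lt_min mc.
    by move=> u; rewrite /= EFin_min lt_min => /andP[/cP ? /cQ].
  - by move=> P Q PQ [c mc cP]; exists c => // u /cP /PQ.
have qc : continuous q.
  move=> u; apply: cvgM; last exact: cvg_cst.
  have cn : `|v - z| @[v --> u] --> `|u - z|.
    by apply: cvg_norm; apply: cvgB; [exact: cvg_id|exact: cvg_cst].
  exact: (cvgM cn cn).
have hcl (c : R) : closed [set u | (h u <= c%:E)%E].
  (* the sublevel sets of h are preimages of the closed epigraph of f *)
  have -> : [set u | (h u <= c%:E)%E] = (fun u => (u, c - q u)) @^-1`
      [set p : E * R | (f p.1 <= p.2%:E)%E].
    by apply/seteqP; split=> u /=; rewrite /h EFinB leeBrDr.
  have gc : continuous (fun u : E => (u, c - q u)).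
    move=> u.
    have cq : (c - q v) @[v --> u] --> c - q u.
      by apply: cvgB; [exact: cvg_cst|exact: qc].
    exact: (cvg_pair (@cvg_id _ (nbhs u)) cq).
  by move/continuous_closedP : gc; apply.
have [p [_ pF]] : edom f `&` cluster F !=set0.
  apply: cpf.
  exists (fine (h x0) + 1) => // u /= hu.
  rewrite /edom/= ltey; apply: contraTneq hu => fuy.
  by rewrite /h fuy addye// -leNgt leey.
exists p => u.
have hp (c : R) : (m < c%:E)%E -> (h p <= c%:E)%E.
  move=> mc; apply: hcl => B Bp.
  apply: pF => //; exists c => // v /=; exact: ltW.
apply: le_trans (mh u).
move: hp mlt; rewrite -/(h p); case: (m) => [r| |] // hp _.
  by apply/lee_addgt0Pr => e e0; rewrite -EFinD hp// lte_fin ltrDl.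
have hpN : (-oo < h p)%E.
  by rewrite /h; case: (f p) (pf.1 p) => //= r _; rewrite ltNyr.
have hpf : h p \is a fin_num.
  by rewrite fin_numElt hpN (le_lt_trans (hp 0 (ltNyr _)))// ltry.
(* the infimum cannot be -oo, as it would be the finite value h p *)
move: (hp (fine (h p) - 1) (ltNyr _)) hpf.
by case: (h p) => //= r; rewrite lee_fin lerDl oppr_ge0 ler10.
Qed.

Lemma prox_dom lam z y : 0 < lam -> is_prox lam f z y -> edom f y.
Proof.
move=> lam0 py; have [x0 dx0] := pf.2.
have := py x0; rewrite /edom /= -(fineK (edom_fin_num dx0)) -EFinD.
by case: (f y) => [r| |] //; rewrite ltry.
Qed.

(** Moving from [y] towards [w] by a fraction [t] changes [f] by at most
[t * (f w - f y)], while the quadratic term changes by its first-order part up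
to [O(t ^ 2)]; minimality of [y] and [t --> 0] leave the subgradient
inequality. *)
Lemma prox_subgradient lam z y : 0 < lam -> is_prox lam f z y ->
  subdifferential dot f y (lam^-1 *: (z - y)).
Proof.
move=> lam0 py w.
have dy := prox_dom lam0 py.
have [dw|] := boolP (f w < +oo)%E; last first.
  by rewrite -leNgt leye_eq => /eqP ->; rewrite leey.
have yE := fineK (edom_fin_num dy); have wE := fineK (edom_fin_num dw).
rewrite -yE -wE -EFinD lee_fin.
set a := fine (f y); set b := fine (f w).
rewrite dotZl.
set d := dot (z - y) (w - y).
(* minimality of y, tested on the segment from y to w; then t tends to 0 *)
have key t : 0 < t < 1 ->
    lam^-1 * d <= b - a + t * (`|w - y| ^+ 2 / (2 * lam)).
  move=> t01; have /andP[t0 t1] := t01.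
  pose v := t *: w + (1 - t) *: y.
  have fv : (f v <= (t * b + (1 - t) * a)%:E)%E.
    by rewrite EFinD !EFinM /a /b yE wE; exact: cvf.
  have := le_trans (py v) (leeD2r (`|v - z| ^+ 2 / (2 * lam))%:E fv).
  rewrite -yE -!EFinD lee_fin -/a.
  have -> : v - z = t *: (w - y) - (z - y).
    rewrite /v scalerBl scale1r scalerBr opprB; rewrite -!addrA; congr (_ + _).
    by rewrite addrCA.
  rewrite (normsqB normE (t *: _)) normsqZ dotZl (dotC _ _ (z - y)) -/d.
  rewrite (distrC y z).
  set A := `|w - y| ^+ 2; set B := `|z - y| ^+ 2.
  have -> : (t ^+ 2 * A - 2 * (t * d) + B) / (2 * lam) =
      t * (t * (A / (2 * lam))) - t * (lam^-1 * d) + B / (2 * lam).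
    by field; rewrite gt_eqF.
  move=> H; rewrite -(ler_pM2l t0); lra.
apply/ler_addgt0Pr => e e0.
set c := `|w - y| ^+ 2 / (2 * lam) in key.
have c0 : 0 <= c by rewrite divr_ge0// mulr_ge0// ltW.
pose t := Num.min (1/2) (e / (c + 1)).
have t01 : 0 < t < 1.
  have ec : 0 < e / (c + 1) by rewrite divr_gt0// ltr_wpDl.
  rewrite lt_min gt_min ec andbT; apply/andP; split; first lra.
  by apply/orP; left; lra.
have := key t t01.
have tc : t * c <= e.
  have : t * (c + 1) <= e by rewrite -ler_pdivlMr ?ge_min ?lexx ?orbT//; lra.
  case/andP: t01; nra.
lra.
Qed.

End prox.

(** * One accelerated step *)

Section acg_algebra.
Context {R : realType} {E : normedModType R} (dot : {dot E for idfun}).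
Hypothesis normE : norm_from_dot dot.
Implicit Types (x y u s : E) (a tau mu L A : R).

(** Completing the square: the hypothesis says that [x'] is the stationary point
of the left-hand side, a quadratic in [u] whose Hessian is
[tau + a * mu / 2] times the identity. *)
Lemma quadratic_recentering a tau mu s x x' y' u :
  (tau + a * mu / 2) *: x' = (mu * a / 2) *: y' + tau *: x - a *: s ->
  tau / 2 * `|u - x| ^+ 2 + a * (dot s (u - y') + mu / 4 * `|u - y'| ^+ 2) =
  tau / 2 * `|x' - x| ^+ 2 + a * (dot s (x' - y') + mu / 4 * `|x' - y'| ^+ 2)
  + (tau + a * mu / 2) / 2 * `|u - x'| ^+ 2.
Proof.
move=> xE.
have H v : (tau + a * mu / 2) * dot x' v =
    mu * a / 2 * dot y' v + tau * dot x v - a * dot s v.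
  by rewrite -dotZl xE linearBl linearDl/= !dotZl.
have Hu := H u; have Hx := H x'.
rewrite !(normsqB normE) !linearBr/=.
rewrite (dotC _ u x) (dotC _ u y') (dotC _ u x') (dotC _ x' x) (dotC _ x' y').
have nx' : `|x'| ^+ 2 = dot x' x' by [].
rewrite nx'; lra.
Qed.

(** With [e = xt - y'], the choice of [xt] turns the two inner products into
[(A + a) * L * |e|^2 + a * L * <e, x' - x>]. Completing a square absorbs the
cross term into [tau / 2 * |x' - x|^2] at the price of
[a^2 * L^2 / (2 * tau) * |e|^2], which the equation for [a] makes exactly half
of the gain. *)
Lemma momentum_bound A a tau L x x' y y' xt : 0 < tau -> 0 < L ->
  (A + a) *: xt = A *: y + a *: x -> L * a ^+ 2 = tau * (A + a) ->
  (A + a) * L / 2 * `|xt - y'| ^+ 2 <=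
  A * (L * dot (xt - y') (y - y')) + a * (L * dot (xt - y') (x' - y'))
  + tau / 2 * `|x' - x| ^+ 2.
Proof.
move=> tau0 L0 xtE aE.
set e := xt - y'.
have H : A * dot e y + a * dot e x = (A + a) * dot e xt.
  by rewrite -[RHS]dotZr xtE linearDr/= !dotZr.
have He : (A + a) * dot e xt = (A + a) * (`|e| ^+ 2 + dot e y').
  by rewrite -(subrK y' xt) -/e linearDr/= -normE.
have sq : 0 <= `|tau *: (x' - x) + (a * L) *: e| ^+ 2 by rewrite exprn_ge0.
move: sq; rewrite (normsqD normE (tau *: _)) !normsqZ dotZl dotZr.
have -> : (a * L) ^+ 2 = L * (tau * (A + a)) by rewrite -aE; ring.
set n := `|x' - x| ^+ 2; set d := dot (x' - x) e.
have -> : tau ^+ 2 * n + 2 * (tau * (a * L * d))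
      + L * (tau * (A + a)) * `|e| ^+ 2 =
    2 * tau * (tau / 2 * n + L * (a * d) + (A + a) * L / 2 * `|e| ^+ 2).
  by field.
rewrite pmulr_rge0; last by rewrite mulr_gt0.
rewrite /d (dotC _ (x' - x)) !linearBr/=.
have LH : L * (A * dot e y + a * dot e x) =
    L * ((A + a) * (`|e| ^+ 2 + dot e y')) by rewrite H He.
lra.
Qed.

End acg_algebra.

Section acg_scalars.
Context {R : realType} {E : normedModType R}.
Implicit Type s : @acg_state R E.

(** [acg_a s] is the positive root of [L * a^2 - tau * a - tau * A = 0]. *)
Lemma acg_a_root s : 0 <= acg_A s -> 0 < acg_tau s -> 0 < acg_L s ->
  acg_L s * acg_a s ^+ 2 = acg_tau s * acg_Anext s.
Proof.
case: s => mu x0 A tau L x y/= A0 t0 L0; rewrite /acg_Anext /acg_a/=.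
set q := Num.sqrt _.
have q2 : q ^+ 2 = tau ^+ 2 + 4 * tau * A * L.
  by rewrite sqr_sqrtr// addr_ge0 ?sqr_ge0// !mulr_ge0// ltW.
have -> : L * ((tau + q) / (2 * L)) ^+ 2 =
    (tau ^+ 2 + 2 * tau * q + q ^+ 2) / (4 * L).
  by field; rewrite gt_eqF.
by rewrite q2; field; rewrite gt_eqF.
Qed.

Lemma acg_a_ge s : 0 <= acg_A s -> 0 < acg_tau s -> 0 < acg_L s ->
  acg_tau s / acg_L s <= acg_a s.
Proof.
case: s => mu x0 A tau L x y/= A0 t0 L0; rewrite /acg_a/=.
set q := Num.sqrt _.
have q2 : tau <= q.
  rewrite -(ger0_norm (ltW t0)) -sqrtr_sqr ler_wsqrtr// lerDl.
  by rewrite !mulr_ge0// ltW.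
rewrite ler_pdivlMr ?mulr_gt0//.
have -> : tau / L * (2 * L) = 2 * tau by field; rewrite gt_eqF.
lra.
Qed.

Lemma acg_a_gt0 s : 0 <= acg_A s -> 0 < acg_tau s -> 0 < acg_L s ->
  0 < acg_a s.
Proof.
by move=> A0 t0 L0; apply: lt_le_trans (acg_a_ge A0 t0 L0); rewrite divr_gt0.
Qed.

(** From [L * a^2 >= tau * A] and [tau >= A * mu / 2] one gets [a >= r * A];
from [a >= tau / L >= 1 / L] the product [A * L] is at least 1 after the first
iteration, whatever the value of [L]. *)
Lemma acg_Anext_growth s (r : R) :
  0 <= acg_A s -> acg_tau s = 1 + acg_A s * acg_mu s / 2 -> 0 < acg_mu s ->
  0 < acg_L s -> 0 <= r -> r ^+ 2 <= acg_mu s / (2 * acg_L s) ->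
  (1 + r) * acg_A s <= acg_Anext s /\ 1 <= acg_Anext s * acg_L s.
Proof.
move=> A0 tE mu0 L0 r0 rle.
have t1 : 1 <= acg_tau s.
  by rewrite tE lerDl divr_ge0// mulr_ge0// ltW.
have t0 : 0 < acg_tau s by apply: lt_le_trans t1.
have a0 := acg_a_gt0 A0 t0 L0.
have aE := acg_a_root A0 t0 L0.
split; last first.
  have := acg_a_ge A0 t0 L0; rewrite ler_pdivrMr// /acg_Anext mulrDl.
  have := mulr_ge0 A0 (ltW L0); lra.
rewrite mulrDl mul1r lerD2l.
suff : (r * acg_A s) ^+ 2 <= acg_a s ^+ 2.
  have ra0 : 0 <= r * acg_A s by rewrite mulr_ge0.
  by rewrite ler_pXn2r ?nnegrE ?(ltW a0).
rewrite -(ler_pM2l L0) aE exprMn.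
have {}rle : r ^+ 2 * (2 * acg_L s) <= acg_mu s.
  by rewrite -ler_pdivlMr// mulr_gt0.
apply: le_trans (_ : acg_tau s * acg_A s <= _); last first.
  by rewrite ler_pM2l// lerDl ltW.
rewrite tE.
have A2 : 0 <= acg_A s ^+ 2 by rewrite sqr_ge0.
have := ler_wpM2r A2 rle.
lra.
Qed.

End acg_scalars.

(** Real-valued form of [psi_s + psi_n], faithful on [edom psin] only. *)
Definition objective {R : realType} {E : normedModType R} (psis : E -> R)
    (psin : E -> \bar R) (u : E) : R :=
  psis u + fine (psin u).

Section acg_step.
Context {R : realType} {E : normedModType R} (dot : {dot E for idfun}).
Context (psis : E -> R) (grad : E -> E) (psin : E -> \bar R).
Context (mubar Lbar chi : R).
Hypotheses (normE : norm_from_dot dot)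
  (cvs : convex_function (setT : set (convex_lmodType E)) psis)
  (gradP : is_gradient dot psis grad) (gradL : Lbar.-lipschitz_setT grad)
  (prn : eproper psin) (cvn : econvex psin)
  (scv : strongly_convex mubar (fun x : E => ((psis x)%:E + psin x)%E)).

Let psi := objective psis psin.

(** Applying the gradient inequality at [z] bounds the gap by
[<grad z - grad zbar, z - zbar>]. This is cruder than the descent lemma by a
factor 2, which only affects the hidden constants. *)
Lemma linearization_gap z zbar :
  psis z - linearization dot psis grad z zbar <= Lbar * `|z - zbar| ^+ 2.
Proof.
have := convex_gradient_ineq cvs gradP z zbar; rewrite /linearization.
have -> : dot (grad z) (zbar - z) = - dot (grad z) (z - zbar).
  by rewrite -linearNr opprB.
have := dot_le_norm normE (grad z - grad zbar) (z - zbar).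
rewrite linearBl/=.
have := ler_wpM2r (normr_ge0 (z - zbar)) (lipschitz_dist_le gradL z zbar).
rewrite -mulrA -expr2; lra.
Qed.

(** Hence the line search never doubles a value above [4 * Lbar / (1 - chi)]. *)
Lemma acg_too_small_lt (s : @acg_state R E) y :
  acg_too_small dot psis grad chi s y -> (1 - chi) * acg_L s / 4 < Lbar.
Proof.
rewrite /acg_too_small => H.
have := linearization_gap y (acg_xtilde s).
have := sqr_ge0 (`|y - acg_xtilde s|).
rewrite ltNge; move=> n0 gap; apply/negP => le.
have := ler_wpM2r n0 le; lra.
Qed.

Section accepted.
Variables (s : @acg_state R E) (y : E).
Hypotheses (L0 : 0 < acg_L s) (yP : acg_candidate grad psin s y)
  (ok : ~ acg_too_small dot psis grad chi s y).
Let e := acg_xtilde s - y.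
Let delta := (1 - chi) * acg_L s / 4 * `|e| ^+ 2.

Lemma candidate_dom : edom psin y.
Proof. by apply: prox_dom yP => //; rewrite divr_gt0. Qed.

Lemma candidate_subgradient :
  subdifferential dot psin y (acg_s s y - grad (acg_xtilde s)).
Proof.
have l0 : 0 < 1 / acg_L s by rewrite divr_gt0.
have := prox_subgradient normE prn cvn l0 yP.
by rewrite mul1r invrK addrAC scalerBr scalerA mulfV ?gt_eqF// scale1r.
Qed.

(** Adds the gradient inequality for [psis] at the extrapolated point to the
subgradient inequality for [psin] at [y]; acceptance of the trial bounds by
[delta] what is lost when [psis y] replaces its linearization. *)
Lemma accepted_lower_model u : edom psin u ->
  psi y + acg_L s * dot e (u - y) - delta <= psi u.
Proof.
move=> du; have := candidate_subgradient u.
rewrite -(fineK (edom_fin_num prn candidate_dom)).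
rewrite -(fineK (edom_fin_num prn du)).
rewrite -EFinD lee_fin linearBl/= /acg_s dotZl -/e.
have := convex_gradient_ineq cvs gradP (acg_xtilde s) u.
move/negP: ok; rewrite /acg_too_small -leNgt /linearization /psi /objective.
rewrite (distrC y) -/e -/delta.
have -> : u - acg_xtilde s = (u - y) + (y - acg_xtilde s).
  by rewrite addrA subrK.
rewrite linearDr/=; lra.
Qed.

(** Strong convexity is assumed of the sum only, so [accepted_lower_model]
cannot be sharpened term by term. Instead it bounds [psi] from below at the
midpoint [w] of [u] and [y]; inserting this in the strong convexity inequality
and doubling restores the slope, doubles [delta] and leaves a
quadratic term. *)
Lemma accepted_strong_lower_model mu u : edom psin u -> mu <= mubar ->
  psi y + acg_L s * dot e (u - y) - 2 * delta + mu / 4 * `|u - y| ^+ 2 <= psi u.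
Proof.
move=> du mule.
pose w : E := (1/2) *: u + (1 - 1/2) *: y.
have half : 0 < (1 / 2 : R) < 1 by lra.
have dw : edom psin w.
  rewrite /edom/= /w; apply: (le_lt_trans (cvn u y half)).
  rewrite -(fineK (edom_fin_num prn candidate_dom)).
  rewrite -(fineK (edom_fin_num prn du)).
  by rewrite -!EFinM -EFinD ltry.
have := scv u y half; rewrite -/w /=.
rewrite -(fineK (edom_fin_num prn candidate_dom)).
rewrite -(fineK (edom_fin_num prn du)).
rewrite -(fineK (edom_fin_num prn dw)) -!EFinD lee_fin.
rewrite -!/(objective _ _ _) -/psi.
have := accepted_lower_model dw.
have -> : w - y = (1/2) *: (u - y).
  by rewrite /w scalerBl scale1r scalerBr addrA addrAC addrK.
rewrite dotZr.
have := ler_wpM2r (sqr_ge0 `|u - y|) mule.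
lra.
Qed.

(** [G] is the sum, with the weights [a] of the iterations done so far, of the
quadratic minorants given by [accepted_strong_lower_model]; [slack] is the
surplus produced by the last iteration, which the restart test measures. *)
Definition estimate_sequence (s : @acg_state R E) (G : E -> R) (slack : R) :
    Prop :=
  (forall u, acg_A s * psi (acg_y s) + slack
      + acg_tau s / 2 * `|u - acg_x s| ^+ 2
     <= G u + `|u - acg_x0 s| ^+ 2 / 2) /\
  (acg_mu s <= mubar -> forall u, edom psin u -> G u <= acg_A s * psi u).

Hypotheses (chi1 : chi < 1) (dy : edom psin (acg_y s)) (A0 : 0 <= acg_A s)
  (mu0 : 0 < acg_mu s) (tE : acg_tau s = 1 + acg_A s * acg_mu s / 2).

(** The new minorant is added to [G] with weight [a]. Only the bound from above
uses strong convexity; in the bound from below the previous iterate is handled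
by the affine minorant, so that it holds for every trial modulus. *)
Lemma estimate_sequence_next G : estimate_sequence s G 0 ->
  exists G', estimate_sequence (acg_next s y) G'
    (chi / 2 * (acg_Anext s * acg_L s * `|e| ^+ 2)).
Proof.
move=> [Glow Gup].
have t0 : 0 < acg_tau s.
  by have := mulr_ge0 A0 (ltW mu0); rewrite tE; lra.
have a0 := acg_a_gt0 A0 t0 L0.
have A'0 : 0 < acg_Anext s by rewrite /acg_Anext ltr_wpDl.
have t'0 : 0 < acg_taunext s.
  by rewrite /acg_taunext addr_gt0// divr_gt0// mulr_gt0.
pose q u := acg_L s * dot e (u - y) + acg_mu s / 4 * `|u - y| ^+ 2.
exists (fun u => G u + acg_a s * (psi y - 2 * delta + q u)).
split => [u|mule u du] /=; last first.
  have := accepted_strong_lower_model du mule; rewrite /q => H.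
  have := Gup mule u du.
  have := ler_wpM2l (ltW a0) H.
  rewrite /acg_Anext; lra.
have xE : (acg_tau s + acg_a s * acg_mu s / 2) *: acg_xnext s y =
    (acg_mu s * acg_a s / 2) *: y + acg_tau s *: acg_x s - acg_a s *: acg_s s y.
  by rewrite /acg_xnext scalerA mulfV ?gt_eqF// scale1r.
have quad := quadratic_recentering normE u xE.
have xtE : (acg_A s + acg_a s) *: acg_xtilde s =
    acg_A s *: acg_y s + acg_a s *: acg_x s.
  by rewrite /acg_xtilde scalerA mulfV ?gt_eqF// scale1r.
have mom := momentum_bound normE (acg_xnext s y) y t0 L0 xtE
  (acg_a_root A0 t0 L0).
rewrite -/e in mom.
have n0 : 0 <= `|acg_xnext s y - y| ^+ 2 by rewrite exprn_ge0.
move: quad; rewrite /acg_s !dotZl -/e => quad.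
have low := Glow u.
have amu : 0 <= acg_a s * (acg_mu s / 4 * `|acg_xnext s y - y| ^+ 2).
  have mu4 : 0 <= acg_mu s / 4 by rewrite divr_ge0// ltW.
  exact: mulr_ge0 (ltW a0) (mulr_ge0 mu4 n0).
have prev : acg_A s * (psi y + acg_L s * dot e (acg_y s - y) - 2 * delta) <=
    acg_A s * psi (acg_y s).
  rewrite ler_wpM2l//; have := accepted_lower_model dy.
  have : 0 <= delta.
    by rewrite mulr_ge0 ?exprn_ge0// divr_ge0// mulr_ge0 ?subr_ge0// ltW.
  lra.
move: prev low quad mom amu; rewrite /q /delta /acg_Anext /acg_taunext.
lra.
Qed.

End accepted.

End acg_step.

(** * Invariant of a cycle *)

Section acg_invariant.
Context {R : realType} {E : normedModType R} (dot : {dot E for idfun}).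
Context (psis : E -> R) (grad : E -> E) (psin : E -> \bar R).
Context (mubar Lbar chi : R).
Hypotheses (normE : norm_from_dot dot)
  (cvs : convex_function (setT : set (convex_lmodType E)) psis)
  (gradP : is_gradient dot psis grad) (gradL : Lbar.-lipschitz_setT grad)
  (prn : eproper psin) (cvn : econvex psin)
  (scv : strongly_convex mubar (fun x : E => ((psis x)%:E + psin x)%E))
  (chi01 : 0 < chi < 1).
Implicit Type s : @acg_state R E.

(** Holds before every trial of the line search. The minorants are not part of
the state of the algorithm, so only the existence of [G] is recorded. *)
Record acg_invariant s : Prop := AcgInvariant {
  acg_inv_A : 0 <= acg_A s;
  acg_inv_L : 0 < acg_L s;
  acg_inv_mu : 0 < acg_mu s;
  acg_inv_tau : acg_tau s = 1 + acg_A s * acg_mu s / 2;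
  acg_inv_x0 : edom psin (acg_x0 s);
  acg_inv_y : edom psin (acg_y s);
  acg_inv_G : exists G, estimate_sequence psis psin mubar s G 0 }.

Lemma acg_inv_pos s : acg_invariant s -> 0 < acg_tau s /\ 0 < acg_a s.
Proof.
case=> A0 L0 mu0 tE _ _ _.
have t0 : 0 < acg_tau s by have := mulr_ge0 A0 (ltW mu0); rewrite tE; lra.
by split=> //; exact: acg_a_gt0.
Qed.

Lemma acg_invariant_start mu x0 M : 0 < mu -> 0 < M -> edom psin x0 ->
  acg_invariant (AcgState mu x0 0 1 M x0 x0).
Proof.
move=> mu0 M0 dx; split => //=; first by rewrite !mul0r addr0.
by exists (fun=> 0); split => [u|_ u _] /=; rewrite !mul0r// !add0r mulrC mul1r.
Qed.

Lemma acg_invariant_double s : acg_invariant s -> acg_invariant (acg_double s).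
Proof. by case: s => ? ? ? ? ? ? ? [] /= *; split => //=; rewrite mulr_gt0. Qed.

Section accepted.
Variables (s : @acg_state R E) (y : E).
Hypotheses (inv : acg_invariant s) (yP : acg_candidate grad psin s y)
  (ok : ~ acg_too_small dot psis grad chi s y).

Lemma acg_invariant_estimate :
  exists G, estimate_sequence psis psin mubar (acg_next s y) G
    (chi / 2 * (acg_Anext s * acg_L s * `|acg_xtilde s - y| ^+ 2)).
Proof.
case: inv => A0 L0 mu0 tE _ dy [G GP]; have /andP[_ chi1] := chi01.
exact: (estimate_sequence_next normE cvs gradP prn cvn scv L0 yP ok chi1 dy A0
  mu0 tE GP).
Qed.

Lemma acg_slack_ge0 :
  0 <= chi / 2 * (acg_Anext s * acg_L s * `|acg_xtilde s - y| ^+ 2).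
Proof.
case: (inv) => A0 L0 _ _ _ _ _; have /andP[chi0 _] := chi01.
have [_ a0] := acg_inv_pos inv.
have AL0 : 0 <= acg_Anext s * acg_L s.
  by rewrite mulr_ge0 ?(ltW L0)// addr_ge0// ltW.
have chi2 : 0 <= chi / 2 by rewrite divr_ge0// ltW.
by rewrite (mulr_ge0 chi2)// mulr_ge0// exprn_ge0.
Qed.

Lemma acg_invariant_next : acg_invariant (acg_next s y).
Proof.
have [G [G1 G2]] := acg_invariant_estimate.
have slack := acg_slack_ge0.
case: (inv) => A0 L0 mu0 tE dx dy _; have [_ a0] := acg_inv_pos inv.
split => //=.
- by rewrite addr_ge0// ltW.
- by rewrite /acg_taunext tE /acg_Anext; ring.
- exact: candidate_dom yP.
- exists G; split => // u; apply: le_trans (G1 u) => /=.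
  by rewrite lerD2r lerD2l.
Qed.

(** At [u = y] the two halves of the estimate sequence give
[A * psi y + slack <= G y + |y - x0|^2 / 2 <= A * psi y + |y - x0|^2 / 2]. *)
Lemma acg_test_true : acg_mu s <= mubar -> acg_test chi s y.
Proof.
move=> mule; have [G [G1 G2]] := acg_invariant_estimate.
have dy : edom psin y by apply: candidate_dom yP => //; case: inv.
have := G2 mule y dy; have := G1 y.
rewrite /acg_test /= (distrC _ (acg_xtilde s)).
have : 0 <= acg_taunext s / 2 * `|y - acg_xnext s y| ^+ 2.
  have [t0 a0] := acg_inv_pos inv; have mu0 := acg_inv_mu inv.
  have am0 := mulr_ge0 (ltW a0) (ltW mu0).
  by rewrite mulr_ge0 ?exprn_ge0// /acg_taunext; lra.
lra.
Qed.

Lemma acg_v_le : `|acg_v grad s y| <= (Lbar + acg_L s) * `|acg_xtilde s - y|.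
Proof.
have L0 := ltW (acg_inv_L inv).
rewrite mulrDl; apply: le_trans (ler_normD _ _) _.
rewrite /acg_s normrZ ger0_norm// lerD2r (distrC (acg_xtilde s)).
exact: lipschitz_dist_le.
Qed.

Lemma acg_v_eps_optimal eps : `|acg_v grad s y| <= eps ->
  eps_optimal dot grad psin eps y (acg_v grad s y).
Proof.
move=> veps; split=> //; exists (acg_s s y - grad (acg_xtilde s)).
  exact: (candidate_subgradient normE prn cvn (acg_inv_L inv) yP).
by rewrite /acg_v addrA addrAC.
Qed.

End accepted.

(** * Counting cycles, iterations and doublings *)

(* A cycle makes at most N iterations that neither stop nor restart it and at
   most J doublings, and the trial modulus is halved at most K times. *)
Section counting.
Variables (mu0 Mbar0 eps D Lhat r : R) (xbar0 : E) (N J K : nat).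
Hypotheses (mubar0 : 0 < mubar) (mu0_ge : mubar <= mu0)
  (Mbar0_gt0 : 0 < Mbar0) (Mbar0_le : Mbar0 <= Lhat)
  (LhatE : Lhat = 8 * Lbar / (1 - chi))
  (eps0 : 0 < eps) (dx0 : edom psin xbar0) (r0 : 0 <= r)
  (rle : r ^+ 2 <= mubar / (4 * Lhat))
  (hD : forall x y, edom psin x -> edom psin y -> `|x - y| <= D)
  (hN : ((Lbar + Lhat) * D) ^+ 2 <= eps ^+ 2 * chi * (1 + r) ^+ N)
  (hJ : forall d, Mbar0 * 2 ^+ d <= Lhat -> (d <= J)%N)
  (hK : forall i, mubar * 2 ^+ i < mu0 -> (i < K)%N).

Let step := rfista_step dot psis grad psin chi Mbar0 eps xbar0.

(** State of the trial modulus in the cycle that follows [k] restarts; the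
second clause records that the value before the last halving exceeded
[mubar]. *)
Definition cycle_ok (k : nat) (mu : R) : Prop :=
  mu * 2 ^+ k = mu0 /\ (k = 0%N \/ mubar < 2 * mu).

(** [n] counts the steps of the run. [k] cycles are complete, each made of at
most [N + 1] iterations and [J] doublings, hence of at most [N + J + 2] steps
with its initialization; the current cycle has made [j] iterations and [d]
doublings. The bounds on [n] are what forces termination. *)
Definition rfista_invariant (n : nat) (c : @rfista_config R E) : Prop :=
  match phase c with
  | CycleStart l M mu => exists k, [/\ l = k.+1, cycle_ok k mu,
      Mbar0 <= M <= Lhat &
      [/\ (iterations c <= k * N.+1)%N,
      (evaluations c <= k * (2 * N.+1 + J))%N &
      (n <= k * (N + J + 2))%N]]
  | Inner l s => exists k j d, [/\ l = k.+1, cycle_ok k (acg_mu s),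
      acg_invariant s,
      [/\ acg_L s <= Lhat, Mbar0 * 2 ^+ d <= acg_L s, (j <= N)%N &
         ((0 < j)%N -> (1 + r) ^+ j.-1 <= acg_A s * acg_L s)] &
      [/\ (iterations c <= k * N.+1 + j)%N,
      (evaluations c <= k * (2 * N.+1 + J) + 2 * j + d)%N &
      (n <= k * (N + J + 2) + 1 + j + d)%N]]
  | Stop y v => [/\ eps_optimal dot grad psin eps y v,
      (iterations c <= K.+1 * N.+1)%N &
      (evaluations c <= K.+1 * (2 * N.+1 + J))%N]
  end.

Lemma cycle_ok_gt k mu : cycle_ok k mu -> mubar < 2 * mu.
Proof.
case=> muE [k0|//]; move: muE; rewrite k0 expr0 mulr1 => ->.
move: mubar0 mu0_ge; lra.
Qed.

Lemma cycle_ok_le k mu : cycle_ok k mu -> (k <= K)%N.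
Proof.
case=> muE [->//|mu2]; case: k muE => // k muE; apply: hK.
by rewrite -muE exprS mulrA ltr_pM2r ?exprn_gt0// mulrC.
Qed.

Lemma Lhat_gt0 : 0 < Lhat. Proof. exact: lt_le_trans Mbar0_le. Qed.

Lemma acg_double_le s y :
  acg_too_small dot psis grad chi s y -> 2 * acg_L s <= Lhat.
Proof.
move=> /(acg_too_small_lt normE cvs gradP gradL); have /andP[_ c1] := chi01.
by rewrite LhatE ler_pdivlMr ?subr_gt0// => ?; lra.
Qed.

(** The trial modulus stays above [mubar / 2] and [acg_L s] below [Lhat], so the
growth ratio [1 + r] is the same in all cycles. *)
Lemma growth_next s k j : acg_invariant s -> cycle_ok k (acg_mu s) ->
  acg_L s <= Lhat -> ((0 < j)%N -> (1 + r) ^+ j.-1 <= acg_A s * acg_L s) ->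
  (1 + r) ^+ j <= acg_Anext s * acg_L s.
Proof.
move=> [A0 L0 mus0 tE _ _ _] /cycle_ok_gt mu2 LL gr.
have rs : r ^+ 2 <= acg_mu s / (2 * acg_L s).
  apply: le_trans rle _; rewrite ler_pdivrMr ?mulr_gt0 ?Lhat_gt0//.
  rewrite mulrAC ler_pdivlMr ?mulr_gt0//.
  have := ler_pM (ltW mubar0) (ltW L0) (ltW mu2) LL; lra.
have [g1 g2] := acg_Anext_growth A0 tE mus0 L0 r0 rs.
case: j gr => [_|j /(_ isT) /= gr]; first by rewrite expr0.
rewrite exprS; apply: le_trans (_ : (1 + r) * (acg_A s * acg_L s) <= _).
  by rewrite ler_wpM2l// addr_ge0.
by rewrite mulrA ler_wpM2r// ltW.
Qed.

(** A passed restart test bounds [chi * (1 + r)^j * |e|^2] by [D^2], while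
[eps < |v| <= (Lbar + Lhat) * |e|]; by [hN] both are possible only for
[j < N]. *)
Lemma not_stopped_lt s y j : acg_invariant s -> acg_candidate grad psin s y ->
  acg_test chi s y -> eps < `|acg_v grad s y| -> acg_L s <= Lhat ->
  (1 + r) ^+ j <= acg_Anext s * acg_L s -> (j < N)%N.
Proof.
move=> inv yP tst big LL gr; rewrite ltnNge; apply/negP => Nj.
have /andP[chi0 _] := chi01.
have L0 := acg_inv_L inv.
have dy := candidate_dom prn L0 yP.
set e := `|acg_xtilde s - y|.
have H1 : eps < (Lbar + Lhat) * e.
  apply: lt_le_trans big _; apply: le_trans (acg_v_le y inv) _.
  by rewrite ler_wpM2r// lerD2l.
have H2 : chi * (1 + r) ^+ N * e ^+ 2 <= D ^+ 2.
  apply: le_trans (_ : `|y - acg_x0 s| ^+ 2 <= _); last first.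
    have dist := hD dy (acg_inv_x0 inv).
    by rewrite ler_pXn2r ?nnegrE// (le_trans _ dist).
  move: tst; rewrite /acg_test (distrC _ (acg_xtilde s)) -/e; apply: le_trans.
  rewrite ler_wpM2r ?sqr_ge0// -mulrA ler_wpM2l ?(ltW chi0)//.
  apply: le_trans gr; rewrite ler_weXn2l// lerDl//.
have e0 : 0 <= e by rewrite normr_ge0.
have LL0 : 0 <= Lbar + Lhat.
  rewrite leNgt; apply/negP => neg.
  have : (Lbar + Lhat) * e <= 0 by rewrite mulr_le0_ge0// ltW.
  by move: H1 eps0; lra.
have H3 : eps ^+ 2 < ((Lbar + Lhat) * e) ^+ 2.
  by rewrite ltr_pXn2r ?nnegrE ?mulr_ge0// ltW.
have P0 : 0 < chi * (1 + r) ^+ N by rewrite mulr_gt0// exprn_gt0// ltr_wpDr.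
have : eps ^+ 2 * (chi * (1 + r) ^+ N) <
    ((Lbar + Lhat) * e) ^+ 2 * (chi * (1 + r) ^+ N).
  by rewrite ltr_pM2r.
rewrite ltNge => /negP; apply.
apply: le_trans (_ : ((Lbar + Lhat) * D) ^+ 2 <= _); last by rewrite mulrA.
rewrite !exprMn -mulrA ler_wpM2l ?sqr_ge0//.
by rewrite mulrC.
Qed.

Lemma rfista_invariant_step n c c' : rfista_invariant n c -> step c c' ->
  rfista_invariant n.+1 c'.
Proof.
move=> inv st; case: st inv.
- move=> l M mu Mlow x0 it ev /andP[]; rewrite ge_max => /andP[_ M1] M2 dx _.
  move=> [k /= [-> ck /andP[_ M3] [itb evb nb]]].
  have mu_gt := cycle_ok_gt ck.
  exists k, 0%N, 0%N; split => //=.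
  + apply: acg_invariant_start => //; last exact: lt_le_trans M1.
    by move: mubar0 mu_gt; lra.
  + by split => //; [exact: le_trans M3|rewrite expr0 mulr1].
  + by move: itb evb nb; clear; split; lia.
- move=> l s y it ev yP small.
  move=> [k [j [d /= [-> ck inv [L1 L2 jN gr] [itb evb nb]]]]].
  exists k, j, d.+1; split => //=.
  + exact: acg_invariant_double.
  + split=> //.
    * exact: acg_double_le small.
    * by rewrite exprS mulrCA ler_pM2l.
    * move=> /gr; move/le_trans; apply; rewrite mulrCA ler_peMl//.
        by rewrite mulr_ge0 ?(acg_inv_A inv)// ltW// (acg_inv_L inv).
      by lra.
  + by move: itb evb nb; clear; split; lia.
- move=> l s y it ev yP ok ntest.
  move=> [k [j [d /= [-> ck inv [L1 L2 jN gr] [itb evb nb]]]]].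
  have dJ : (d <= J)%N by apply: hJ; exact: le_trans L1.
  exists k.+1; split => //=.
  + split; first by case: ck => <- _; rewrite exprS; field.
    right; rewrite mulrC divfK//.
    by rewrite ltNge; apply/negP => le; apply: ntest; exact: acg_test_true.
  + rewrite L1 andbT; apply: le_trans L2; rewrite ler_peMr ?(ltW Mbar0_gt0)//.
    by rewrite exprn_ege1// ler1n.
  + by move: itb evb nb jN dJ; clear; split; lia.
- move=> l s y it ev yP ok tst vle.
  move=> [k [j [d /= [_ ck inv [L1 L2 jN gr] [itb evb nb]]]]].
  have dJ : (d <= J)%N by apply: hJ; exact: le_trans L1.
  have kK := cycle_ok_le ck.
  split; first exact: acg_v_eps_optimal.
  + apply: leq_trans (_ : k.+1 * N.+1 <= _)%N; last by rewrite leq_mul.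
    by move: itb evb jN dJ; clear; rewrite mulSn /=; lia.
  + apply: leq_trans (_ : k.+1 * (2 * N.+1 + J) <= _)%N; last first.
      by rewrite leq_mul.
    by move: itb evb jN dJ; clear; rewrite mulSn /=; lia.
- move=> l s y it ev yP ok tst vgt.
  move=> [k [j [d /= [-> ck inv [L1 L2 jN gr] [itb evb nb]]]]].
  have gr' := growth_next inv ck L1 gr.
  have jN' := not_stopped_lt inv yP tst vgt L1 gr'.
  exists k, j.+1, d; split => //=.
  + exact: acg_invariant_next.
  + by move: itb evb nb; clear; split; lia.
Qed.

Lemma rfista_invariant_start : rfista_invariant 0 (rfista_start mu0 Mbar0).
Proof.
exists 0%N; split => //; last by rewrite lexx.
by split; [rewrite expr0 mulr1|left].
Qed.

Lemma rfista_invariant_progress n c : eclosed psin -> compact (edom psin) ->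
  rfista_invariant n c -> rfista_stopped c \/ exists c', step c c'.
Proof.
move=> cln cpn; case: c => -[l M mu|l s|y v] it ev; last by left; exists y, v.
- move=> [k /= [_ _ /andP[M1 M2] _]]; right.
  exists (Config (Inner l (AcgState mu xbar0 0 1 M xbar0 xbar0)) it ev).
  apply: step_init => //; rewrite lexx andbT ge_max M1 andbT.
  by have := lt_le_trans Mbar0_gt0 M1; lra.
- move=> _; right.
  have [y yP] := prox_exists prn cln cpn (1 / acg_L s)
    (acg_xtilde s - (1 / acg_L s) *: grad (acg_xtilde s)).
  have [small|ok] := pselect (acg_too_small dot psis grad chi s y).
    by eexists; apply: step_double yP small.
  have [tst|ntst] := pselect (acg_test chi s y); last first.
    by eexists; apply: step_restart yP ok ntst.
  have [vle|vgt] := leP (`|acg_v grad s y|) eps.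
    by eexists; apply: step_stop yP ok tst vle.
  by eexists; apply: step_next yP ok tst vgt.
Qed.

Lemma rfista_reachable_progress c : eclosed psin -> compact (edom psin) ->
  rfista_reachable step (rfista_start mu0 Mbar0) c ->
  rfista_stopped c \/ exists c', step c c'.
Proof.
move=> cln cpn rc; suff [n nP] : exists n, rfista_invariant n c.
  exact: rfista_invariant_progress nP.
elim: rc => [|c1 c2 _ [n IH] st].
  by exists 0%N; exact: rfista_invariant_start.
by exists n.+1; exact: rfista_invariant_step st.
Qed.

Lemma rfista_run_stops run : rfista_run step (rfista_start mu0 Mbar0) run ->
  exists n it ev y v, [/\ run n = Config (Stop y v) it ev,
    eps_optimal dot grad psin eps y v,
    (it <= K.+1 * N.+1)%N & (ev <= K.+1 * (2 * N.+1 + J))%N].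
Proof.
move=> [run0 runS].
suff [n [[y [v ph]] inv]] :
    exists n, rfista_stopped (run n) /\ rfista_invariant n (run n).
  move: inv; rewrite /rfista_invariant ph => -[opt itb evb].
  exists n, (iterations (run n)), (evaluations (run n)), y, v; split=> //.
  by rewrite -ph; case: (run n).
have claim n :
    (exists m, rfista_stopped (run m) /\ rfista_invariant m (run m)) \/
    rfista_invariant n (run n).
  elim: n => [|n [|inv]]; last 2 first; [by left| |].
    have [st|[stop _]] := runS n.
      by right; exact: rfista_invariant_step st.
    by left; exists n.
  by right; rewrite run0; exact: rfista_invariant_start.
(* the largest value of the step counter compatible with the invariant *)
pose B := (K * (N + J + 2) + 1 + N + J)%N.
have [//|inv] := claim B.+1.
have [stop|nstop] := pselect (rfista_stopped (run B.+1)); first by exists B.+1.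
exfalso; move: inv nstop; rewrite /rfista_invariant /rfista_stopped.
case: (phase _) => [l M mu|l s|y v].
- move=> [k [_ /cycle_ok_le kK _ [_ _ nb]]] _.
  have : (k * (N + J + 2) <= K * (N + J + 2))%N by rewrite leq_mul2r kK orbT.
  by rewrite /B in nb; move: nb; clear; lia.
- move=> [k [j [d [_ /cycle_ok_le kK _ [L1 L2 jN _] [_ _ nb]]]]] _.
  have dJ : (d <= J)%N by apply: hJ; exact: le_trans L1.
  have : (k * (N + J + 2) <= K * (N + J + 2))%N by rewrite leq_mul2r kK orbT.
  by rewrite /B in nb; move: nb jN dJ; clear; lia.
- by move=> _ ns; apply: ns; exists y, v.
Qed.

End counting.
End acg_invariant.

(** * Numerical bounds on the counts *)

Section counts.
Context {R : realType}.
Implicit Types (x c r : R).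

Lemma ln2_gt0 : 0 < ln 2 :> R. Proof. by rewrite ln_gt0// ltr1n. Qed.

Lemma log2_exp2_le x (d : nat) : 2 ^+ d <= x -> d%:R <= log2 x.
Proof.
move=> h; have x0 : 0 < x by apply: lt_le_trans h; rewrite exprn_gt0.
rewrite /log2 ler_pdivlMr ?ln2_gt0// mulr_natl -lnXn//.
by rewrite ler_ln ?posrE ?exprn_gt0.
Qed.

Lemma log2_exp2_lt x (d : nat) : 2 ^+ d < x -> d%:R < log2 x.
Proof.
move=> h; have x0 : 0 < x by apply: lt_trans h; rewrite exprn_gt0.
rewrite /log2 ltr_pdivlMr ?ln2_gt0// mulr_natl -lnXn//.
by rewrite ltr_ln ?posrE ?exprn_gt0.
Qed.

Lemma log2M x y : 0 < x -> 0 < y -> log2 (x * y) = log2 x + log2 y.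
Proof. by move=> x0 y0; rewrite /log2 lnM ?posrE// mulrDl. Qed.

Lemma ler_log2 x y : 0 < x -> x <= y -> log2 x <= log2 y.
Proof.
move=> x0 xy; rewrite ler_pM2r ?invr_gt0 ?ln2_gt0//.
by rewrite ler_ln ?posrE// (lt_le_trans x0).
Qed.

Lemma log2_ge0 x : 1 <= x -> 0 <= log2 x.
Proof. by move=> x1; rewrite divr_ge0 ?ln_ge0 ?ler1n. Qed.

Lemma halvings_count x : exists K : nat, [/\ (0 < K)%N,
  K%:R = (Num.ceil (log2pp x))%:~R :> R & forall i, 2 ^+ i < x -> (i < K)%N].
Proof.
have c1 : 1 <= log2pp x by rewrite /log2pp le_max lexx orbT.
have c2 : 1 <= (Num.ceil (log2pp x))%:~R :> R.
  by rewrite (le_trans c1)// ceil_ge.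
have c3 : 0 < Num.ceil (log2pp x) by rewrite -(ltr0z R) (lt_le_trans _ c2).
have KE : `|Num.ceil (log2pp x)|%N%:R = (Num.ceil (log2pp x))%:~R :> R.
  by rewrite natr_absz gtr0_norm.
exists `|Num.ceil (log2pp x)|%N; split => //.
  by rewrite absz_gt0 gt_eqF.
move=> i /log2_exp2_lt ix; rewrite -(ltr_nat R) KE.
apply: lt_le_trans ix (le_trans _ (ceil_ge _)).
by rewrite le_max lexx.
Qed.

Lemma doublings_count c x : 1 <= c * x -> 0 < x -> 1 <= c -> exists J : nat,
  J%:R <= log2 c + log2p x /\ forall d, 2 ^+ d <= c * x -> (d <= J)%N.
Proof.
move=> cx x0 c1; have c0 : 0 < c by apply: lt_le_trans c1.
exists (Num.truncn (log2 (c * x))); split.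
  apply: le_trans (_ : log2 (c * x) <= _); first by rewrite truncn_le log2_ge0.
  by rewrite log2M// lerD2l /log2p le_max lexx.
by move=> d /log2_exp2_le; rewrite truncn_ge_nat// log2_ge0.
Qed.

(** [ln (1 + u) <= u] at [u = - r / (1 + r)]. *)
Lemma inv_ln1D_le r : 0 < r -> (ln (1 + r))^-1 <= (1 + r) / r.
Proof.
move=> r0; have r1 : 0 < 1 + r by rewrite addr_gt0.
rewrite -[leRHS]invf_div lef_pV2 ?posrE ?divr_gt0 ?ln_gt0 ?ltrDl//.
have := @le_ln1Dx _ (- (r / (1 + r))).
have -> : 1 + - (r / (1 + r)) = (1 + r)^-1 by field; rewrite gt_eqF.
rewrite lnV ?posrE// lerN2; apply.
rewrite ltrN2 ltr_pdivrMr// mul1r; lra.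
Qed.

Lemma iterations_count r (Q : R) : 0 < r -> exists N : nat,
  Q <= (1 + r) ^+ N /\ N%:R <= 1 + Num.max (ln Q) 0 * ((1 + r) / r).
Proof.
move=> r0; have r1 : 0 < 1 + r by rewrite addr_gt0.
have l0 : 0 < ln (1 + r) by rewrite ln_gt0// ltrDl.
set m := Num.max _ _.
have m0 : 0 <= m by rewrite le_max lexx orbT.
have mr : 0 <= m / ln (1 + r) by rewrite divr_ge0// ltW.
exists (Num.truncn (m / ln (1 + r))).+1; split; last first.
  rewrite -natr1 addrC lerD2l; apply: le_trans (_ : m / ln (1 + r) <= _).
    by rewrite truncn_le.
  by rewrite ler_wpM2l// inv_ln1D_le.
have [Q0|Q0] := leP Q 0; first by rewrite (le_trans Q0)// exprn_ge0// ltW.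
rewrite -ler_ln ?posrE ?exprn_gt0// lnXn// -mulr_natl.
rewrite -ler_pdivrMr//; apply: le_trans (_ : m / ln (1 + r) <= _).
  by rewrite ler_pM2r ?invr_gt0// le_max lexx.
by have /andP[_ /ltW] := truncn_itv mr.
Qed.

End counts.

Section bounds.
Context {R : realType}.

(** A domain reduced to a point gives [x = 0]; there [ln 0 = 0], and the bound
persists because [logpp] is at least 1. *)
Lemma ln_scaled_square_le (k x : R) : 1 <= k -> 0 <= x ->
  Num.max (ln (k * x ^+ 2)) 0 <= (2 + ln k) * logpp x.
Proof.
move=> k1 x0; have k0 : 0 < k by apply: lt_le_trans k1.
have lk : 0 <= ln k by rewrite ln_ge0.
have P1 : 1 <= logpp x by rewrite /logpp le_max lexx orbT.
have h0 : 0 <= 2 + ln k by rewrite addr_ge0.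
have kP : 0 <= (2 + ln k) * (logpp x - 1) by rewrite mulr_ge0 ?subr_ge0.
rewrite ge_max; apply/andP; split; last by lra.
have [x00|x00] := leP x 0.
  have -> : x = 0 by apply/eqP; rewrite eq_le x00.
  by rewrite expr0n mulr0 ln0// mulr_ge0// le_max ler01 orbT.
rewrite lnM ?posrE ?exprn_gt0// lnXn//.
have : ln x <= logpp x by rewrite /logpp le_max lexx.
have : 0 <= ln k * (logpp x - 1) by rewrite mulr_ge0 ?subr_ge0.
rewrite -mulr_natl; lra.
Qed.

(** The number of iterations is about [ln Q / r], where [Q] is a multiple
of [(D * Lbar / eps)^2] and [1 / r] a multiple of [sqrt (Lbar / mubar)], both
with factors depending on [chi]. The lower bound [kappa] on [Lbar / mubar]
absorbs the remaining constants. *)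
Lemma cycle_length_bound (chi kappa : R) : 0 < chi < 1 -> 0 < kappa ->
  exists2 c : R, 0 < c & forall Lbar mubar D eps : R,
    0 < Lbar -> 0 < mubar -> 0 <= D -> 0 < eps ->
    exists (r : R) (N : nat), [/\ 0 <= r,
      r ^+ 2 <= mubar / (4 * (8 * Lbar / (1 - chi))),
      ((Lbar + 8 * Lbar / (1 - chi)) * D) ^+ 2 <= eps ^+ 2 * chi * (1 + r) ^+ N
    & kappa <= Lbar / mubar ->
      N.+1%:R <= c * (Num.sqrt (Lbar / mubar) * logpp (D * Lbar / eps))].
Proof.
move=> /andP[chi0 chi1] kappa0.
have d0 : 0 < 1 - chi by rewrite subr_gt0.
pose m := 8 / (1 - chi); have m0 : 0 < m by rewrite divr_gt0.
pose k := (1 + m) ^+ 2 / chi.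
have k1 : 1 <= k.
  rewrite ler_pdivlMr// mul1r; apply: le_trans (ltW chi1) _.
  by rewrite exprn_ege1// lerDl ltW.
have lk : 0 <= ln k by rewrite ln_ge0.
(* b * sqrt (Lbar / mubar) >= 1, and 1 / r = w * sqrt (Lbar / mubar) *)
pose b := (Num.sqrt kappa)^-1; have b0 : 0 < b by rewrite invr_gt0 sqrtr_gt0.
pose w := Num.sqrt (4 * m); have w0 : 0 < w by rewrite sqrtr_gt0 mulr_gt0.
exists (2 * b + (2 + ln k) * (b + w)).
  have h0 : 0 < 2 + ln k by rewrite ltr_pwDl.
  by apply: addr_gt0; apply: mulr_gt0 => //; exact: addr_gt0.
move=> L mu D eps L0 mu0 D0 eps0.
pose S := Num.sqrt (L / mu); have S0 : 0 < S by rewrite sqrtr_gt0 divr_gt0.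
pose X := D * L / eps; have X0 : 0 <= X by rewrite divr_ge0 ?mulr_ge0// ltW.
pose r := Num.sqrt (mu / (4 * (8 * L / (1 - chi)))).
have M0 : 0 < mu / (4 * (8 * L / (1 - chi))) by rewrite !(divr_gt0, mulr_gt0).
have r0 : 0 < r by rewrite sqrtr_gt0.
have rwS : r^-1 = w * S.
  have : r * (w * S) = 1.
    have m4 : 0 < 4 * m by rewrite mulr_gt0.
    rewrite /r /w /S -(sqrtrM _ (ltW m4)) -(sqrtrM _ (ltW M0)).
    rewrite -[RHS]sqrtr1; congr Num.sqrt; rewrite /m; field.
    by rewrite !gt_eqF.
  move=> E; apply: (mulfI (lt0r_neq0 r0)); rewrite E mulfV ?gt_eqF//.
have [N [NQ NB]] := iterations_count (k * X ^+ 2) r0.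
exists r, N; split.
- exact: ltW.
- by rewrite sqr_sqrtr// ltW.
- apply: le_trans (_ : eps ^+ 2 * chi * (k * X ^+ 2) <= _).
    rewrite le_eqVlt; apply/orP; left; apply/eqP; rewrite /k /m /X.
    by field; rewrite !gt_eqF.
  by rewrite ler_wpM2l// mulr_ge0 ?exprn_ge0// ltW.
move=> kap; rewrite -/S -/X; set P := logpp X.
have P1 : 1 <= P by rewrite /P /logpp le_max lexx orbT.
have bS : 1 <= b * S.
  by rewrite mulrC ler_pdivlMr ?sqrtr_gt0// mul1r ler_wsqrtr.
have lnQ := ln_scaled_square_le k1 X0; rewrite -/P in lnQ.
have rr : (1 + r) / r = 1 + w * S by rewrite -rwS; field; rewrite gt_eqF.
rewrite rr in NB.
have wS0 : 0 <= 1 + w * S by rewrite addr_ge0// mulr_ge0// ltW.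
have := ler_wpM2r wS0 lnQ => H.
have bSP : P <= b * S * P by rewrite ler_peMl// (le_trans _ P1).
have H2 : 0 <= (2 + ln k) * (b * S * P - P).
  by rewrite mulr_ge0 ?subr_ge0// addr_ge0.
rewrite -natr1.
move: NB H H2 bSP P1; clear; set z := Num.max _ _; lra.
Qed.

End bounds.

Lemma dist_le_diameter {R : realType} {E : normedModType R} (A : set E) :
  compact A -> forall x y, A x -> A y -> `|x - y| <= diameter A.
Proof.
move=> /compact_bounded; rewrite /bounded_set => -[M [_ MA]] x y Ax Ay.
apply: ub_le_sup; last by exists x, y.
have bnd z : A z -> `|z| <= M + 1 by apply: MA; rewrite ltrDl.
exists (M + 1 + (M + 1)) => _ [u [v [Au Av ->]]].
by rewrite (le_trans (ler_normB _ _))// lerD ?bnd.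
Qed.

(** Every factor other than [S * ln X], with [S] the square root and [X] the
argument of the logarithm, is bounded in terms of [rho], [sigma] and [theta];
the additive terms are absorbed through [S >= sqrt kappa] and
[ln X >= ln theta > 0]. *)
Lemma complexity_le_main_term (R : realType) (kappa rho sigma theta : R) :
  0 < kappa -> 1 < theta -> exists2 c : R, 0 < c &
  forall mubar Lbar D mu0 Mbar0 eps : R,
    0 < mubar -> 0 < Lbar -> 0 < mu0 -> 0 < Mbar0 ->
    kappa <= Lbar / mubar -> mu0 / mubar <= rho -> Lbar / Mbar0 <= sigma ->
    theta <= D * Lbar / eps ->
    1 + rfista_complexity mubar Lbar D mu0 Mbar0 eps <=
      c * (Num.sqrt (Lbar / mubar) * ln (D * Lbar / eps)).
Proof.
move=> kappa0 th1.
have lt0 : 0 < ln theta by rewrite ln_gt0.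
pose t := (ln theta)^-1; have t0 : 0 < t by rewrite invr_gt0.
pose b := (Num.sqrt kappa)^-1; have b0 : 0 < b by rewrite invr_gt0 sqrtr_gt0.
pose K := log2pp rho + 1.
have K0 : 0 < K by rewrite ltr_pwDr// le_max ler01 orbT.
have s0 : 0 <= log2p sigma by rewrite le_max lexx orbT.
have bt := mulr_gt0 b0 t0.
exists (b * t + K * ((1 + t) + log2p sigma * (b * t))).
  apply: addr_gt0 => //; apply: mulr_gt0 => //.
  apply: ltr_pwDl; first exact: addr_gt0.
  by rewrite mulr_ge0// ltW.
move=> mu L D mu0 M0 eps mu_gt0 L0 mu0_gt0 M0_gt0 kap rh sg tX.
rewrite /rfista_complexity.
set S := Num.sqrt (L / mu); set X := D * L / eps.
have X0 : 0 < X by apply: lt_le_trans tX; apply: lt_trans th1.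
have bS : 1 <= b * S.
  by rewrite mulrC ler_pdivlMr ?sqrtr_gt0// mul1r ler_wsqrtr.
have S0 : 0 < S by rewrite sqrtr_gt0 divr_gt0.
have lX : ln theta <= ln X by rewrite ler_ln ?posrE// (lt_trans _ th1).
have lX0 : 0 < ln X by apply: lt_le_trans lX.
have tl : 1 <= t * ln X by rewrite mulrC ler_pdivlMr// mul1r.
have P1 : logpp X <= (1 + t) * ln X.
  rewrite mulrDl mul1r ge_max; apply/andP; split; last by lra.
  by rewrite lerDl mulr_ge0// ltW.
have KE : (Num.ceil (log2pp (mu0 / mu)))%:~R <= K.
  have h : log2pp (mu0 / mu) <= log2pp rho.
    by rewrite /log2pp ge_max !le_max lexx orbT andbT ler_log2// divr_gt0.
  by have := ceilB1_lt (log2pp (mu0 / mu)); rewrite intrD rmorphN1 /K; lra.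
have ls : log2p (L / M0) <= log2p sigma.
  by rewrite /log2p ge_max !le_max lexx orbT andbT ler_log2// divr_gt0.
have l0 : 0 <= log2p (L / M0) by rewrite le_max lexx orbT.
have T1 : 1 <= b * t * (S * ln X).
  by rewrite mulrACA -[leLHS]mulr1 ler_pM.
rewrite mulrDl lerD// -mulrA; apply: ler_pM => //.
- by rewrite ler0z ceil_ge0 (lt_le_trans (ltrN10 _))// le_max ler01 orbT.
- rewrite addr_ge0// mulr_ge0 ?ltW// (lt_le_trans ltr01)// le_max lexx orbT//.
rewrite mulrDl lerD//; first by rewrite mulrCA ler_pM2l.
by rewrite -mulrA -[leLHS]mulr1 ler_pM.
Qed.

(** * The complexity theorem *)

Theorem theorem3p3 (R : realType) (chi kappa : R)
    (chi01 : 0 < chi < 1) (kappa_gt0 : 0 < kappa) :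
  (* hidden constant of the first bound: depends on chi, kappa only *)
  exists2 C : R, 0 < C &
  forall (rho sigma theta : R), 1 < theta ->
  (* hidden constant of the second bound *)
  exists2 C' : R, 0 < C' &
  forall (E : normedModType R) (dot : {dot E for idfun})
    (psis : E -> R) (grad : E -> E) (psin : E -> \bar R)
    (mubar Lbar D mu0 Mbar0 eps : R) (xbar0 : E),
  finite_dimensional (E := E) ->
  norm_from_dot dot ->
  convex_function (setT : set (convex_lmodType E)) psis ->
  is_gradient dot psis grad ->
  Lbar.-lipschitz_setT grad ->
  eproper psin -> eclosed psin -> econvex psin ->
  compact (edom psin) ->
  convex_set (edom psin : set (convex_lmodType E)) ->
  D = diameter (edom psin) ->
  0 < mubar ->
  strongly_convex mubar (fun x : E => ((psis x)%:E + psin x)%E) ->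
  0 < mu0 -> 0 < Mbar0 -> 0 < eps -> edom psin xbar0 ->
  mubar <= mu0 -> Mbar0 <= 2 * Lbar ->
  let step := rfista_step dot psis grad psin chi Mbar0 eps xbar0 in
  let start := rfista_start mu0 Mbar0 in
  (* every step of the algorithm can be carried out *)
  (forall c, rfista_reachable step start c ->
     rfista_stopped c \/ exists c', step c c') /\
  (* whatever the choices made, it stops with an eps-optimal solution *)
  (forall run, rfista_run step start run ->
     exists (n it ev : nat) (y v : E),
     [/\ run n = Config (Stop y v) it ev,
         eps_optimal dot grad psin eps y v,
         kappa <= Lbar / mubar ->
           it%:R <= C * (1 + rfista_complexity mubar Lbar D mu0 Mbar0 eps) /\
           ev%:R <= C * (1 + rfista_complexity mubar Lbar D mu0 Mbar0 eps)
       & kappa <= Lbar / mubar ->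
         mu0 / mubar <= rho -> Lbar / Mbar0 <= sigma ->
         theta <= D * Lbar / eps ->
           it%:R <= C' * (Num.sqrt (Lbar / mubar) * ln (D * Lbar / eps)) /\
           ev%:R <= C' * (Num.sqrt (Lbar / mubar) * ln (D * Lbar / eps))]).
Proof.
have /andP[chi0 chi1] := chi01.
have d0 : 0 < 1 - chi by rewrite subr_gt0.
have [c c0 cycleP] := cycle_length_bound chi01 kappa_gt0.
pose b := (Num.sqrt kappa)^-1; have b0 : 0 < b by rewrite invr_gt0 sqrtr_gt0.
pose m := 8 / (1 - chi).
have m1 : 1 <= m by rewrite /m ler_pdivlMr//; lra.
have lm : 0 <= log2 m := log2_ge0 m1.
pose C := 2 * (2 * c + log2 m * b + 1).
have C0 : 0 < C.
  by have := mulr_ge0 lm (ltW b0); rewrite /C; move: c0; clear; lra.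
exists C => // rho sigma theta th1.
have [c' c'0 secondP] := complexity_le_main_term rho sigma kappa_gt0 th1.
exists (C * c'); first exact: mulr_gt0.
move=> E dot psis grad psin mubar Lbar D mu0 Mbar0 eps xbar0 _ normE cvs gradP
  gradL prn cln cvn cpn _ DE mubar0 scv mu0_gt0 Mbar0_gt0 eps0 dx0 mu0_ge
  Mbar0_le step start.
have L0 : 0 < Lbar by lra.
have hD x y : edom psin x -> edom psin y -> `|x - y| <= D.
  by rewrite DE; exact: dist_le_diameter.
have D0 : 0 <= D by apply: le_trans (hD _ _ dx0 dx0).
have [r [N [r0 rle hN NB]]] := cycleP Lbar mubar D eps L0 mubar0 D0 eps0.
have [K [K0 KE hK0]] := halvings_count (mu0 / mubar).
have hK i : mubar * 2 ^+ i < mu0 -> (i < K)%N.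
  by move=> h; apply: hK0; rewrite ltr_pdivlMr// mulrC.
have LM : 8 * Lbar / (1 - chi) = m * Lbar by rewrite /m mulrAC.
have M1 : Mbar0 <= 8 * Lbar / (1 - chi).
  rewrite ler_pdivlMr//; apply: le_trans (_ : Mbar0 * 1 <= _); last by lra.
  by rewrite ler_pM2l//; lra.
have [J [JB hJ0]] : exists J : nat, J%:R <= log2 m + log2p (Lbar / Mbar0) /\
    forall d, 2 ^+ d <= m * (Lbar / Mbar0) -> (d <= J)%N.
  apply: doublings_count => //; last exact: divr_gt0.
  by rewrite mulrA ler_pdivlMr// mul1r -LM.
have hJ d : Mbar0 * 2 ^+ d <= 8 * Lbar / (1 - chi) -> (d <= J)%N.
  by move=> h; apply: hJ0; rewrite mulrA ler_pdivlMr// mulrC -LM.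
split => [c1|run runP].
  by apply: (rfista_reachable_progress normE cvs gradP gradL prn cvn scv chi01
    mubar0 mu0_ge Mbar0_gt0 M1 erefl eps0 dx0 r0 rle hD hN hJ hK).
have [n [it [ev [y [v [runE opt itb evb]]]]]] :=
  rfista_run_stops normE cvs gradP gradL prn cvn scv chi01
    mubar0 mu0_ge Mbar0_gt0 M1 erefl eps0 r0 rle hD hN hJ hK runP.
have first_bound : kappa <= Lbar / mubar ->
    it%:R <= C * (1 + rfista_complexity mubar Lbar D mu0 Mbar0 eps) /\
    ev%:R <= C * (1 + rfista_complexity mubar Lbar D mu0 Mbar0 eps).
  move=> kap; have := NB kap; rewrite /rfista_complexity -KE.
  set S := Num.sqrt _; set P := logpp _; set l := log2p _ => NB'.
  have P1 : 1 <= P by rewrite le_max lexx orbT.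
  have l0 : 0 <= l by rewrite le_max lexx orbT.
  have bS : 1 <= b * S.
    by rewrite mulrC ler_pdivlMr ?sqrtr_gt0// mul1r ler_wsqrtr.
  have bSP : 1 <= b * (S * P) by rewrite mulrA -[leLHS]mulr1 ler_pM.
  have T0 : 0 <= S * P by rewrite mulr_ge0 ?sqrtr_ge0 ?(le_trans ler01 P1).
  (* iterations and evaluations obey the same bound: K + 1 <= 2 K cycles of at
     most 2 (N + 1) + J gradient evaluations *)
  have total p : (p <= K.+1 * (2 * N.+1 + J))%N ->
      p%:R <= C * (1 + K%:R * (S * P + l)).
    rewrite -(ler_nat R) natrM natrD natrM => /le_trans; apply.
    have per_cycle :
        2 * N.+1%:R + J%:R <= (2 * c + log2 m * b + 1) * (S * P + l).
      have := ler_wpM2l lm bSP.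
      have := mulr_ge0 (ltW c0) l0; have := mulr_ge0 (mulr_ge0 lm (ltW b0)) l0.
      by move: NB' JB; rewrite -/l; move: T0; clear; lra.
    have K1 : K.+1%:R <= 2 * K%:R :> R.
      by rewrite -natrM ler_nat; move: K0; clear; lia.
    have n0 : 0 <= 2 * N.+1%:R + J%:R :> R by rewrite addr_ge0// mulr_ge0.
    apply: le_trans (ler_pM (ler0n _ _) n0 K1 per_cycle) _.
    by rewrite /C; move: C0; rewrite /C; clear; lra.
  split; apply: total => //; apply: leq_trans itb _; rewrite leq_mul2l /=.
  by clear; lia.
exists n, it, ev, y, v; split => // kap rh sg tX.
have := secondP mubar Lbar D mu0 Mbar0 eps mubar0 L0 mu0_gt0 Mbar0_gt0
  kap rh sg tX.
rewrite -(ler_pM2l C0) mulrA => cplx; have [i1 i2] := first_bound kap.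
by split; [exact: le_trans i1 cplx|exact: le_trans i2 cplx].
Qed.
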